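(* Let $\mathcal{B}$ be a uniformly convex separable Banach space over $\mathbb{R}$ with a Schauder basis. Then $\mathcal{B}$ and $\mathcal{B}^*$ are duals as character groups, i.e. $\mathcal{B}^*=\hat{\mathcal{B}}$: the map assigning to $\mathbf{x}^*\in\mathcal{B}^*$ the character $\mathbf{y}\mapsto\exp\{-2\pi i\langle\mathbf{y},\mathbf{x}^*\rangle\}$ of $\mathcal{B}$ is an isomorphism of the group $\mathcal{B}^*$ onto $\hat{\mathcal{B}}$.
   Context: $\mathcal{B}^*$ is the (continuous) dual Banach space and $\langle\mathbf{y},\mathbf{x}^*\rangle$ the pairing of $\mathbf{y}\in\mathcal{B}$ with $\mathbf{x}^*\in\mathcal{B}^*$. A character of an abelian topological group $G$ is a homomorphism $\alpha:G\to\mathbb{C}$ into the complex numbers of modulus one; $\hat G$ denotes the group of all continuous characters of $G$, with group operation the pointwise product, $(\alpha_1+\alpha_2)(g)=\alpha_1(g)\alpha_2(g)$. $\mathcal{B}$ is regarded as a topological group under addition with its norm topology. *)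

(* Defs.v *)
From HB Require Import structures.
From mathcomp Require Import all_boot all_order all_algebra.
From mathcomp Require Import complex.
From mathcomp Require Import all_classical all_reals all_analysis.

Set Implicit Arguments.
Unset Strict Implicit.
Unset Printing Implicit Defensive.

Import Order.TTheory GRing.Theory Num.Theory.
Import numFieldNormedType.Exports.

Local Open Scope classical_set_scope.
Local Open Scope ring_scope.

Definition separable_space (T : topologicalType) : Prop :=
  exists A : set T, countable A /\ dense A.

Definition uniformly_convex (R : realType) (B : normedModType R) : Prop :=
  forall eps : R, 0 < eps -> exists2 delta : R, 0 < delta &
    forall x y : B, `|x| = 1 -> `|y| = 1 -> eps <= `|x - y| ->
      `|2^-1 *: (x + y)| <= 1 - delta.

Definition schauder_basis (R : realType) (B : normedModType R) (e : nat -> B)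
    : Prop :=
  forall x : B, exists! a : nat -> R,
    series (fun k => a k *: e k) @ \oo --> x.

(* R[i] carries the topology of the modulus only once it is seen as a
   numFieldType; its head symbol alone does not trigger the inference. *)
Definition cplx (R : realType) : numFieldType := R[i]%C.

Definition cexp (R : realType) (z : cplx R) : cplx R :=
  (expR (complex.Re z) * cos (complex.Im z)
   +i* (expR (complex.Re z) * sin (complex.Im z)))%C.

Section dual.
Variables (R : realType) (B : normedModType R).

Definition dual_pred : {pred B -> R^o} :=
  mem [set f : B -> R^o | linear f /\ continuous f].

Lemma dual_submod_closed : submod_closed dual_pred.
Proof.
split.
  by rewrite inE; split; [move=> a x y; rewrite /= scaler0 addr0|exact: cst_continuous].
move=> a f g; rewrite !inE => -[lf cf] [lg cg]; split.
  move=> b x y /=.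
  have E z : (a *: f + g) z = a *: f z + g z by [].
  by rewrite !E lf lg !scalerDr !scalerA [b * a]mulrC -!addrA;
    congr (_ + _); rewrite addrCA.
move=> x; apply: (@cvgD _ _ _ _ _ (a *: f) g); last exact: cg.
by apply: cvgZr; exact: cf.
Qed.

HB.instance Definition _ :=
  GRing.isSubmodClosed.Build R (B -> R^o) dual_pred dual_submod_closed.

Record dual := Dual {
  dual_fun :> B -> R^o ;
  dual_funP : dual_fun \in dual_pred }.

HB.instance Definition _ := [isSub for dual_fun].
HB.instance Definition _ := [Choice of dual by <:].
HB.instance Definition _ := [SubChoice_isSubLmodule of dual by <:].

End dual.

Section character.
Variables (R : realType) (G : topologicalZmodType).

Record character := Character {
  char_fun :> G -> cplx R ;
  char_norm : forall g, `|char_fun g| = 1 ;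
  char_morph : forall g h, char_fun (g + h) = char_fun g * char_fun h ;
  char_continuous : continuous char_fun }.

Lemma character_ext (a b : character) : a =1 b -> a = b.
Proof.
case: a b => [f f1 f2 f3] [g g1 g2 g3] /= /funext fg.
by case: _ / fg in g1 g2 g3 *; congr Character; exact: Prop_irrelevance.
Qed.

HB.instance Definition _ := gen_eqMixin character.
HB.instance Definition _ := gen_choiceMixin character.

Lemma char_neq0 (a : character) g : a g != 0.
Proof. by rewrite -normr_eq0 char_norm oner_eq0. Qed.

Definition char_zero : character.
Proof.
exists (fun=> 1) => [g|g h|]; first exact: normr1.
  by rewrite mulr1.
exact: cst_continuous.
Defined.

Definition char_opp (a : character) : character.
Proof.
exists (fun g => (a g)^-1) => [g|g h|g].
- by rewrite normfV char_norm invr1.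
- by rewrite char_morph invfM.
- by apply: cvgV; [exact: char_neq0|exact: char_continuous].
Defined.

Definition char_add (a b : character) : character.
Proof.
exists (fun g => a g * b g) => [g|g h|g].
- by rewrite normrM !char_norm mulr1.
- by rewrite !char_morph mulrACA.
- by apply: cvgM; exact: char_continuous.
Defined.

Lemma char_addA : associative char_add.
Proof. by move=> a b c; apply: character_ext => g; exact: mulrA. Qed.

Lemma char_addC : commutative char_add.
Proof. by move=> a b; apply: character_ext => g; exact: mulrC. Qed.

Lemma char_add0 : left_id char_zero char_add.
Proof. by move=> a; apply: character_ext => g; exact: mul1r. Qed.

Lemma char_addN : left_inverse char_zero char_opp char_add.
Proof.
by move=> a; apply: character_ext => g; exact: mulVf (char_neq0 a g).
Qed.

HB.instance Definition _ :=
  GRing.isZmodule.Build character char_addA char_addC char_add0 char_addN.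

End character.

(* Main.v *)
Require Import Defs.
From HB Require Import structures.
From mathcomp Require Import all_boot all_order all_algebra.
From mathcomp Require Import complex.
From mathcomp Require Import all_classical all_reals all_analysis.
From mathcomp Require Import lra.

(** Write [expi a] for the point of angle [a] on the unit circle.  A continuous
    linear form [f] gives the character [expi (- 2 pi f)], and two different
    forms give different characters because a nonzero real linear form takes
    every real value, in particular values that are not integers.

    The substance is that every continuous character [chi] of a real normed
    space has this shape ([character_phase]), which is a lifting through the
    covering [expi] of the circle.  Near the origin [chi] stays in the right
    half-plane, so it has the phase [th = asin (Im chi)], with values in
    [[- pi / 2, pi / 2]].  If [x], [y] and [x + y] are all near the origin, then
    [th (x + y) - th x - th y] is a multiple of [2 pi] of modulus at most
    [3 pi / 2], hence zero: the phase is locally additive.  As a real vector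
    space is divisible, such a bounded locally additive function extends to the
    whole space by [x |-> n th (x / n)] with [n] large; the extension is
    additive and bounded on balls, which forces it to be linear and continuous
    ([dual_extension]).  It is a global phase because
    [chi x = chi (x / n) ^+ n]. *)

Set Implicit Arguments.
Unset Strict Implicit.
Unset Printing Implicit Defensive.

Import Order.TTheory GRing.Theory Num.Theory.
Import numFieldNormedType.Exports.

Local Open Scope classical_set_scope.
Local Open Scope ring_scope.

(** * The circle *)

Definition expi (R : realType) (a : R) : cplx R := (cos a +i* sin a)%C.

Lemma expi0 (R : realType) : expi (0 : R) = 1.
Proof. by rewrite /expi cos0 sin0. Qed.

Lemma expiD (R : realType) (a b : R) : expi (a + b) = expi a * expi b.
Proof. by rewrite /expi cosD sinD [sin a * _ + _]addrC. Qed.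

Lemma norm_expi (R : realType) (a : R) : `|expi a| = 1.
Proof. by rewrite /expi /cplx normc_def /= cos2Dsin2 sqrtr1. Qed.

Lemma expiMn (R : realType) (a : R) n : expi (a *+ n) = expi a ^+ n.
Proof.
elim: n => [|n IH]; first by rewrite mulr0n expr0 expi0.
by rewrite mulrS expiD IH exprS.
Qed.

Lemma cexp_exponent (R : realType) (t : R) :
  cexp (- (2%:R * (@pi R)%:C * 'i * t%:C))%C = expi (- (2 * pi * t)).
Proof.
have -> : (- (2%:R * (@pi R)%:C * 'i * t%:C))%C =
    (0 +i* (- (2 * pi * t)))%C :> R[i].
  rewrite -complexiE mulrAC -mulrA [X in - X]mulrC.
  (* [simpc] computes only with real constants embedded by [%:C]. *)
  have -> : (2%:R = (2%:R : R)%:C :> R[i])%C by rewrite rmorph_nat.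
  by simpc; rewrite mulrC.
by rewrite /cexp /= expR0 !mul1r.
Qed.

Lemma normc_le_ReIm (R : realType) (z : cplx R) :
  `|z| <= (`|complex.Re z| + `|complex.Im z|)%:C%C.
Proof.
rewrite {1}/cplx normc_def lecR -(@ler_pXn2r _ 2) ?nnegrE ?sqrtr_ge0 ?addr_ge0 //.
rewrite sqr_sqrtr ?addr_ge0 ?sqr_ge0 // sqrrD !real_normK ?num_real //.
by rewrite addrAC lerDl mulrn_wge0 ?mulr_ge0.
Qed.

Lemma continuous_expi (R : realType) : continuous (@expi R).
Proof.
move=> a; apply/cvgrPdist_lt => e e0.
(* The positive elements of [R[i]] are real, so it is enough to bound both
   coordinates by half of a real radius. *)
have [d ed] : exists d : R, e = d%:C%C.
  by move: e0; case: e => x y; rewrite ltcE /= => /andP[/eqP -> _]; exists x.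
have d0 : 0 < d by move: e0; rewrite ed ltcR.
have h : 0 < d / 2 by rewrite divr_gt0.
have /cvgrPdist_lt/(_ _ h) cosC := @continuous_cos R a.
have /cvgrPdist_lt/(_ _ h) sinC := @continuous_sin R a.
near=> b.
have H := normc_le_ReIm (expi a - expi b).
apply: (le_lt_trans H); rewrite ed ltcR /=.
rewrite (splitr d) ltrD //; near: b.
- exact: cosC.
- exact: sinC.
Unshelve. all: by end_near. Qed.

(** The half angle has sine zero, and it lies in the interval [-pi, pi] without
    its end points, where the sine vanishes only at the origin. *)
Lemma expi_eq1 (R : realType) (a : R) : `|a| < 2 * pi -> expi a = 1 -> a = 0.
Proof.
move=> a2 [ca _].
have s0 : sin (a / 2) = 0.
  have : cos (a / 2 *+ 2) = 1 by rewrite -mulr_natr divfK.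
  rewrite cos_mulr2n cos2sin2 => h; apply/eqP; rewrite -sqrf_eq0; apply/eqP.
  by lra.
have pi0 := pi_gt0 R.
have [a0|a0|//] := ltgtP a 0.
- have : 0 < sin (- (a / 2)).
    move: a2; rewrite ltr0_norm // => a2.
    by apply: sin_gt0_pi; apply/andP; split; lra.
  by rewrite sinN s0 oppr0 ltxx.
- have : 0 < sin (a / 2).
    move: a2; rewrite gtr0_norm // => a2.
    by apply: sin_gt0_pi; apply/andP; split; lra.
  by rewrite s0 ltxx.
Qed.

(** The arcsine of the imaginary part is a choice of the argument on the right
    half of the circle, because there the real part is the positive root of
    [1 - b ^+ 2]. *)
Lemma expi_asin (R : realType) (z : cplx R) : `|z| = 1 -> 0 < complex.Re z ->
  expi (asin (complex.Im z)) = z /\ `|asin (complex.Im z)| <= pi / 2.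
Proof.
case: z => a b; rewrite /cplx normc_def /= => -[ab1] a0.
have ab : a ^+ 2 + b ^+ 2 = 1.
  by rewrite -[LHS]sqr_sqrtr ?addr_ge0 ?sqr_ge0 // ab1 expr1n.
have b1 : -1 <= b <= 1.
  by rewrite -ler_norml -(@ler_pXn2r _ 2) ?nnegrE // real_normK ?num_real //
    expr1n -ab lerDr sqr_ge0.
split; last by rewrite ler_norml asin_geNpi2 ?asin_lepi2.
rewrite /expi cos_asin // asinK ?in_itv //=.
by rewrite -ab addrK sqrtr_sqr gtr0_norm.
Qed.

(** * Extension of locally additive functions *)

Section extension.
Variables (R : realType) (V : normedModType R) (th : V -> R) (r M : R).
Hypothesis r0 : 0 < r.
Hypothesis thD : forall x y,
  `|x| < r -> `|y| < r -> `|x + y| < r -> th (x + y) = th x + th y.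
Hypothesis thM : forall x, `|x| < r -> `|th x| <= M.

Lemma local_additiveMn x n : `|x *+ n| < r -> th (x *+ n) = th x *+ n.
Proof.
elim: n => [|n IH] h.
  rewrite !mulr0n.
  by have := @thD 0 0; rewrite addr0 !normr0 => /(_ r0 r0 r0) h0; lra.
(* The smaller multiples of [x] stay in the ball, so additivity applies. *)
have le m : (m <= n.+1)%N -> `|x *+ m| < r.
  by move=> mn; apply: le_lt_trans h; rewrite !normrMn ler_wpMn2l.
rewrite mulrSr thD ?IH -?mulrSr ?le //.
by rewrite -[x]mulr1n le.
Qed.

Definition rescaled (n : nat) (x : V) : R := th (n%:R^-1 *: x) *+ n.

(** Any scale that brings [x] into the ball gives the same value
    ([additive_extensionE]); the least one is taken. *)
Definition additive_extension (x : V) : R :=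
  rescaled (Num.truncn (`|x| / r)).+1 x.

Lemma norm_rescale n (x : V) : (0 < n)%N -> `|x| < n%:R * r ->
  `|n%:R^-1 *: x| < r.
Proof.
move=> n0 h; rewrite normrZ normfV normr_nat mulrC ltr_pdivrMr ?ltr0n //.
by rewrite mulrC.
Qed.

Lemma rescaledM n m x : (0 < n)%N -> (0 < m)%N -> `|x| < n%:R * r ->
  rescaled (n * m) x = rescaled n x.
Proof.
move=> n0 m0 h.
have E : ((n * m)%:R^-1 *: x) *+ m = n%:R^-1 *: x.
  rewrite -scaler_nat scalerA natrM invfM mulrCA divff ?mulr1 //.
  by rewrite pnatr_eq0 -lt0n.
rewrite /rescaled -E local_additiveMn ?E ?norm_rescale //.
by rewrite -mulrnA [(m * n)%N]mulnC.
Qed.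

(** Two admissible scales [n] and [m] are compared through their product. *)
Lemma additive_extensionE n x : (0 < n)%N -> `|x| < n%:R * r ->
  additive_extension x = rescaled n x.
Proof.
move=> n0 h; rewrite /additive_extension; set m := _.+1.
have hm : `|x| < m%:R * r by rewrite -ltr_pdivrMr // truncnS_gt.
by rewrite -(@rescaledM m n) // mulnC rescaledM.
Qed.

Lemma exists_scale (a : R) : exists2 n, (0 < n)%N & a < n%:R * r.
Proof.
by exists (Num.truncn (a / r)).+1 => //; rewrite -ltr_pdivrMr // truncnS_gt.
Qed.

(** A single scale can serve [x], [y] and [x + y] at once, and at that scale
    additivity is the local one. *)
Lemma additive_extensionD x y :
  additive_extension (x + y) = additive_extension x + additive_extension y.
Proof.
have [n n0 h] := exists_scale (`|x| + `|y|).
have hx : `|x| < n%:R * r by apply: le_lt_trans h; rewrite lerDl.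
have hy : `|y| < n%:R * r by apply: le_lt_trans h; rewrite lerDr.
have hxy : `|x + y| < n%:R * r by apply: le_lt_trans h; rewrite ler_normD.
rewrite !(@additive_extensionE n) // /rescaled scalerDr thD ?mulrnDl //;
  rewrite -?scalerDr; exact: norm_rescale.
Qed.

Lemma additive_extension_bounded n x : (0 < n)%N -> `|x| < n%:R * r ->
  `|additive_extension x| <= M *+ n.
Proof.
move=> n0 h; rewrite (@additive_extensionE n) // /rescaled normrMn.
by rewrite lerMn2r thM ?orbT // norm_rescale.
Qed.

End extension.

(** With [m] the integral part of [n * a] and [u] the fractional part, additivity
    gives [n * (f (a *: x) - a * f x) = f (u *: x) - u * f x].  The right-hand
    side is bounded independently of [n], so the defect of homogeneity is
    smaller than every positive number. *)
Lemma bounded_additiveZ (R : realType) (V : normedModType R)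
    (f : {additive V -> R}) :
  (forall x : V, exists C : R, forall y : V, `|y| <= `|x| -> `|f y| <= C) ->
  forall a x, f (a *: x) = a * f x.
Proof.
move=> fb a x; have [C fC] := fb x.
apply/eqP; rewrite -subr_eq0 -normr_le0; apply/ler_addgt0Pl => e e0.
rewrite addr0.
set n := (Num.truncn ((C + C) / e)).+1.
have hn : C + C < n%:R * e by rewrite -ltr_pdivrMr // truncnS_gt.
have n0 : 0 < n%:R :> R by rewrite ltr0n.
rewrite -(ler_pM2l n0); apply: le_trans (ltW hn).
rewrite -{1}[n%:R]normr_nat -normrM.
set m := Num.floor (n%:R * a).
have /andP[m1 m2] := floor_itv (n%:R * a).
pose u : R := n%:R * a - m%:~R.
have u0 : 0 <= u by rewrite subr_ge0.
have u1 : u <= 1 by move: m2; rewrite -/m intrD mulr1z /u => /ltW; lra.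
have E : n%:R * f (a *: x) = m%:~R * f x + f (u *: x).
  rewrite mulr_natl -raddfMn -scaler_nat scalerA.
  have -> : n%:R * a = m%:~R + u by rewrite /u; lra.
  by rewrite scalerDl raddfD scaler_int raddfMz mulrzl.
have -> : n%:R * (f (a *: x) - a * f x) = f (u *: x) - u * f x.
  by rewrite mulrBr E /u; lra.
apply: le_trans (ler_normB _ _) _; apply: lerD.
  by apply: fC; rewrite normrZ ger0_norm // ler_piMl.
rewrite normrM ger0_norm //; apply: le_trans (fC _ (lexx _)).
by rewrite ler_piMl.
Qed.

Lemma dual_linear (R : realType) (V : normedModType R) (f : dual V) :
  linear f.
Proof. by have := dual_funP f; rewrite inE => -[]. Qed.

HB.instance Definition _ (R : realType) (V : normedModType R) (f : dual V) :=
  GRing.isLinear.Build R V R^o *:%R (dual_fun f) (dual_linear f).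

(** The bound [M] serves twice: it makes the additive extension homogeneous, and
    then continuous, a linear map bounded near the origin being continuous. *)
Lemma dual_extension (R : realType) (V : normedModType R) (th : V -> R)
    (r M : R) : 0 < r ->
  (forall x y, `|x| < r -> `|y| < r -> `|x + y| < r ->
    th (x + y) = th x + th y) ->
  (forall x, `|x| < r -> `|th x| <= M) ->
  exists f : dual V, forall x, `|x| < r -> f x = th x.
Proof.
move=> r0 thD thM; pose f : V -> R := additive_extension th r.
have fB : zmod_morphism f.
  move=> x y; have := additive_extensionD r0 thD (x - y) y.
  by rewrite -/f subrK => ->; rewrite addrK.
pose fa : {additive V -> R} :=
  HB.pack f (GRing.isZmodMorphism.Build V R f fB).
have flin : linear (f : V -> R^o).
  have fZ : forall a x, f (a *: x) = a * f x.
    apply: (@bounded_additiveZ _ _ fa) => x.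
    have [n n0 h] := exists_scale r0 `|x|.
    exists (M *+ n) => y yx.
    by apply: (additive_extension_bounded r0 thD thM n0);
      apply: le_lt_trans h.
  move=> a x y.
  have -> : f (a *: x + y) = f (a *: x) + f y := raddfD fa _ _.
  by rewrite fZ.
pose fl : {linear V -> R^o} :=
  HB.pack (f : V -> R^o) (GRing.isLinear.Build R V R^o *:%R f flin).
have fE x : `|x| < r -> f x = th x.
  move=> xr; rewrite /f (@additive_extensionE _ _ _ _ r0 thD 1%N) ?mul1r //.
  by rewrite /rescaled mulr1n invr1 scale1r.
have fP : (f : V -> R^o) \in @dual_pred R V.
  rewrite inE; split=> //.
  apply: (@bounded_linear_continuous _ _ _ fl); apply/ex_bound; exists M.
  apply/nbhs_norm0P; exists r => //= x xr.
  by have := thM x xr; rewrite -(fE x xr).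
by exists (Dual fP).
Qed.

(** * Characters of a normed space *)

Lemma char0 {R : realType} {G : topologicalZmodType} (chi : character R G) :
  chi 0 = 1.
Proof.
apply: (mulfI (char_neq0 chi 0)).
by rewrite mulr1 -char_morph addr0.
Qed.

Lemma charMn {R : realType} {G : topologicalZmodType} (chi : character R G)
  x n : chi (x *+ n) = chi x ^+ n.
Proof.
elim: n => [|n IH]; first by rewrite mulr0n expr0 char0.
by rewrite mulrS char_morph IH exprS.
Qed.

(** The local phase extends to a linear form [f], and [expi \o f] agrees with
    [chi] near the origin, hence everywhere by taking powers. *)
Lemma character_phase (R : realType) (V : normedModType R)
    (chi : character R V) :
  exists f : dual V, forall x, chi x = expi (f x : R).
Proof.
have [r r0 hr] : exists2 r : R, 0 < r &
    forall x, `|x| < r -> 0 < complex.Re (chi x).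
  have /cvgrPdist_lt/(_ _ ltr01) := @char_continuous _ _ chi 0.
  move=> /nbhs_norm0P[r /= r0 h]; exists r => // x xr.
  have /= := h x xr; rewrite char0 => {}h.
  have := le_lt_trans (normc_ge_Re _) h.
  rewrite ltcR; case: (chi x) => a b /=.
  by rewrite ltr_norml => /andP[_]; lra.
have pi0 := pi_gt0 R.
pose th x := asin (complex.Im (chi x)).
have thE x : `|x| < r -> expi (th x) = chi x /\ `|th x| <= pi / 2.
  by move=> xr; apply: expi_asin; rewrite ?char_norm ?hr.
have [f fE] : exists f : dual V, forall x, `|x| < r -> f x = th x.
  apply: (@dual_extension _ _ th r (pi / 2)) => //; last first.
    by move=> x /thE[].
  move=> x y /thE[ex bx] /thE[ey byy] /thE[exy bxy].
  (* Three angles of at most [pi / 2] add up to less than a full turn. *)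
  apply/eqP; rewrite -subr_eq0; apply/eqP/expi_eq1.
    move: bx byy bxy; rewrite !ler_norml ltr_norml.
    by move=> /andP[? ?] /andP[? ?] /andP[? ?]; apply/andP; split; lra.
  have nz := char_neq0 chi (x + y).
  apply: (mulIf nz); rewrite mul1r {1}char_morph -ex -ey -!expiD subrK.
  exact: exy.
exists f => x.
have [n n0 h] := exists_scale r0 `|x|.
have -> : x = (n%:R^-1 *: x) *+ n.
  by rewrite -scaler_nat scalerA divff ?scale1r // pnatr_eq0 -lt0n.
have xr := norm_rescale n0 h.
rewrite charMn -(thE _ xr).1 -expiMn -fE //.
by rewrite raddfMn.
Qed.

Definition dual_character (R : realType) (V : normedModType R)
  (f : dual V) : character R V.
Proof.
exists (fun y => expi (- (2 * pi * (f y : R)))) => [y|x y|].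
- exact: norm_expi.
- rewrite -expiD; congr expi.
  by rewrite raddfD mulrDr opprD.
- have := dual_funP f; rewrite inE => -[_ fc] y.
  apply: (@continuous_comp _ _ _ (fun y => - (2 * pi * (f y : R))) (@expi R)).
    by apply: cvgN; apply: cvgM; [exact: cvg_cst|exact: fc].
  exact: continuous_expi.
Defined.

Lemma dual_character_zmod_morphism (R : realType) (V : normedModType R) :
  zmod_morphism (@dual_character R V).
Proof.
move=> f g; apply: character_ext => y.
have -> : (dual_character f - dual_character g) y =
  expi (- (2 * pi * (f y : R))) / expi (- (2 * pi * (g y : R))) by [].
apply: (mulIf (char_neq0 (dual_character g) y)).
rewrite divfK ?(char_neq0 (dual_character g) y) // -expiD; congr expi.
have -> : (f - g) y = f y - g y by [].
by rewrite mulrBr opprB addrAC subrr sub0r.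
Qed.

(** If [f y] and [g y] differ, rescaling [y] makes the difference [1 / 2]; at this
    point the two characters differ by the factor [expi pi]. *)
Lemma dual_character_inj (R : realType) (V : normedModType R) :
  injective (@dual_character R V).
Proof.
move=> f g fg; apply/val_inj/funext => y /=.
pose a : R := f y; pose b : R := g y; change (a = b).
apply/eqP; rewrite -subr_eq0; apply/negP => /negP d0.
pose t : R := (2 * (a - b))^-1.
have fa : f (t *: y) = t * a :> R by exact: linearZ.
have gb : g (t *: y) = t * b :> R by exact: linearZ.
have tE : t * (a - b) = 2^-1 by rewrite /t invfM mulfVK.
have pi0 := pi_gt0 R.
suff : pi = 0 :> R by move=> h; rewrite h ltxx in pi0.
apply: expi_eq1; first by rewrite gtr0_norm //; lra.
have gN0 := char_neq0 (dual_character f) (t *: y).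
apply: (mulIf gN0); rewrite mul1r [in RHS]fg /= -expiD fa gb; congr expi.
have := congr1 (fun s => 2 * pi * s) tE; rewrite /=; lra.
Qed.

Lemma dual_character_surj (R : realType) (V : normedModType R)
    (chi : character R V) : exists f : dual V, dual_character f = chi.
Proof.
have [f fE] := character_phase chi.
exists (- (2 * pi)^-1 *: f); apply: character_ext => y.
rewrite fE; congr expi.
have -> : (- (2 * pi)^-1 *: f) y = - (2 * pi)^-1 * f y by [].
rewrite mulNr mulrN opprK mulVKf // mulf_neq0 // ?pnatr_eq0 //.
by rewrite gt_eqF // pi_gt0.
Qed.

Theorem theorem5p8 (R : realType) (B : completeNormedModType R)
    (hconvex : uniformly_convex B)
    (hseparable : separable_space B)
    (hbasis : exists e : nat -> B, schauder_basis e) :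
  exists Phi : {additive dual B -> character R B},
    (forall (xs : dual B) (y : B),
       Phi xs y = cexp (- (2%:R * (@pi R)%:C * 'i * (xs y : R)%:C))%C) /\
    bijective Phi.
Proof.
pose Phi : {additive dual B -> character R B} :=
  HB.pack (@dual_character R B) (GRing.isZmodMorphism.Build _ _
    (@dual_character R B) (@dual_character_zmod_morphism R B)).
exists Phi; split=> [xs y|]; first by rewrite cexp_exponent.
have [g gK] := choice (@dual_character_surj R B).
by exists g => // f; apply: (@dual_character_inj R B); exact: gK.
Qed.
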